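(* Let $r\ge0$ and let $\gamma=\{\gamma_{ij}\}_{i,j\ge0}$ be a recursive doubly indexed sequence (RDIS) with initial conditions $\{\gamma_{ij}\}_{0\le i\le j\le r}$ and characteristic polynomial $P(z,\bar z)=z^{r+1}-\sum_{0\le l+k\le r}a_{lk}\bar z^lz^k$. The following are equivalent: (i) there exists a positive Borel measure $\mu$ on $\mathbb{C}$ such that $\gamma_{ij}=\int\bar z^iz^j\,d\mu$ for all $i,j\ge0$; (ii) there exists a positive Borel measure $\mu$ on $\mathbb{C}$ such that $\gamma_{ij}=\int\bar z^iz^j\,d\mu$ for all $0\le i\le j\le r$ and $\operatorname{supp}(\mu)\subset Z(P):=\{z\in\mathbb{C}:P(z,\bar z)=0\}$.
   Context: RDIS: a sequence $\gamma=\{\gamma_{ij}\}_{i,j\ge0}$ of complex numbers with $\gamma_{00}>0$ is an RDIS with characteristic polynomial $P=z^{r+1}-\sum_{0\le l+k\le r}a_{lk}\bar z^lz^k$ ($a_{lk}\in\mathbb{C}$) and initial conditions $\{\gamma_{ij}\}_{0\le i\le j\le r}$ if $\gamma_{ji}=\overline{\gamma_{ij}}$ for all $i,j\ge0$ and $\gamma_{i,n+1}=\sum_{0\le l+k\le r}a_{lk}\gamma_{l+i,n+k-r}$ for all $i\ge0$, $n\ge r$. The set $Z(P)$ is known to be finite, with at most $(r+1)^2$ points. *)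

(* Defs.v *)
From mathcomp Require Import all_boot all_order all_algebra.
From mathcomp Require Import complex.
From mathcomp Require Import all_classical all_reals all_analysis.

Set Implicit Arguments.
Unset Strict Implicit.
Unset Printing Implicit Defensive.

Import Order.TTheory GRing.Theory Num.Theory.
Import numFieldNormedType.Exports.

Local Open Scope classical_set_scope.
Local Open Scope ring_scope.

(* [R[i]] carries its norm topology through the alias [R[i]^o]; the radii of
   its balls are the positive elements of [R[i]], that is, the positive reals. *)
Definition Cborel (R : realType) := g_sigma_algebraType (@open R[i]^o).

Section ComplexIntegral.
Context {R : realType} (mu : {measure set (Cborel R) -> \bar R}).
Implicit Type f : R[i] -> R[i].

Definition cintegrable f : Prop :=
  mu.-integrable [set: Cborel R] (fun z : Cborel R => (complex.Re (f z))%:E) /\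
  mu.-integrable [set: Cborel R] (fun z : Cborel R => (complex.Im (f z))%:E).

Definition cintegral f : R[i] :=
  Complex (Rintegral mu [set: Cborel R] (fun z : Cborel R => complex.Re (f z)))
          (Rintegral mu [set: Cborel R] (fun z : Cborel R => complex.Im (f z))).

Definition msupp : set R[i] :=
  [set z | forall U : set R[i]^o, open U -> U z -> (0 < mu U)%E].

(* [cintegral] is total, with a junk value on non-integrable functions, so that
   "the (i, j)-moment of [mu] is [c]" has to require integrability. *)
Definition is_moment (i j : nat) (c : R[i]) : Prop :=
  cintegrable (fun z => conjc z ^+ i * z ^+ j) /\
  c = cintegral (fun z => conjc z ^+ i * z ^+ j).

End ComplexIntegral.

Section RDIS.
Context {R : realType}.

(* Only the coefficients [a l k] with [l + k <= r] are used. *)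
Definition charP (r : nat) (a : nat -> nat -> R[i]) (z : R[i]) : R[i] :=
  z ^+ r.+1 -
  \sum_(l < r.+1) \sum_(k < r.+1 | (l + k <= r)%N) a l k * conjc z ^+ l * z ^+ k.

Definition zeroset (r : nat) (a : nat -> nat -> R[i]) : set R[i] :=
  [set z | charP r a z = 0].

(* In [R[i]], [0 < c] means that [c] is real and positive. The initial
   conditions of the sequence are its own entries [gamma i j], [i <= j <= r]. *)
Definition RDIS (r : nat) (a gamma : nat -> nat -> R[i]) : Prop :=
  [/\ 0 < gamma 0%N 0%N,
      forall i j : nat, gamma j i = conjc (gamma i j) &
      forall i n : nat, (r <= n)%N ->
        gamma i n.+1 =
        \sum_(l < r.+1) \sum_(k < r.+1 | (l + k <= r)%N)
           a l k * gamma (l + i)%N (n + k - r)%N].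

End RDIS.

(* Main.v *)
(* The recurrence says exactly that the functional of [gamma] vanishes on
   P(z, zbar) zbar^i z^m for all i and m. If [mu] represents [gamma], then
   expanding the conjugate of P gives int |P|^2 dmu = 0, so the open set P <> 0
   is null. Conversely, C being second countable, the complement of the support
   is null, so P = 0 almost everywhere; then the moment of zbar^i z^j with
   i <= j and j > r is a combination of moments of smaller total degree i + j,
   and induction on i + j (conjugating when i > j) yields both the
   integrability of every monomial and the value of its integral. *)

Require Import Defs.
From mathcomp Require Import all_boot all_order all_algebra.
From mathcomp Require Import complex.
From mathcomp Require Import all_classical all_reals all_analysis.
From mathcomp Require Import measurable_realfun.
From mathcomp Require Import zify lra.

Import Order.TTheory GRing.Theory Num.Theory.
Import numFieldNormedType.Exports.

Local Open Scope classical_set_scope.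
Local Open Scope ring_scope.

(** * Topology of the complex plane in real coordinates *)

Section ComplexPlane.
Context {R : realType}.
Local Notation Re := (@complex.Re R).
Local Notation Im := (@complex.Im R).
Implicit Types (z w : R[i]) (f g : R[i] -> R[i]).

Lemma ReD z w : Re (z + w) = Re z + Re w.
Proof. by case: z w => [? ?] []. Qed.

Lemma ImD z w : Im (z + w) = Im z + Im w.
Proof. by case: z w => [? ?] []. Qed.

Lemma ReN z : Re (- z) = - Re z. Proof. by case: z. Qed.

Lemma ImN z : Im (- z) = - Im z. Proof. by case: z. Qed.

Lemma ReM z w :
  Re (z * w) = Re z * Re w - Im z * Im w.
Proof. by case: z w => [? ?] []. Qed.

Lemma ImM z w :
  Im (z * w) = Re z * Im w + Im z * Re w.
Proof. by case: z w => [? ?] []. Qed.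

Lemma ReJ z : Re (conjc z) = Re z. Proof. by case: z. Qed.

Lemma ImJ z : Im (conjc z) = - Im z. Proof. by case: z. Qed.

(** A positive radius in [R[i]] has zero imaginary part, so discs may be described by real radii. *)
Lemma open_complexP (U : set R[i]^o) :
  open U <-> forall z, U z ->
    exists2 e : R, 0 < e & forall w, `|w - z| < (Complex e 0) -> U w.
Proof.
rewrite openE; split=> [oU z /oU /nbhs_ballP[[e e'] /=]|H z /H[e e0 zU]].
  rewrite ltcE /= => /andP[/eqP-> e0] zU; exists e => // w wz.
  by apply: zU; rewrite -ball_normE /= distrC.
apply/nbhs_ballP; exists (Complex e 0); first by rewrite /= ltcE /= eqxx.
by move=> w; rewrite -ball_normE /= distrC; exact: zU.
Qed.

Lemma normc_lt (e : R) z : `|z| < Complex e 0 ->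
  `|Re z| < e /\ `|Im z| < e.
Proof.
rewrite normc_def ltcE /= eqxx /= => ze.
have e0 : 0 <= e by rewrite (le_trans _ (ltW ze))// sqrtr_ge0.
split; apply: le_lt_trans ze; rewrite -sqrtr_sqr ler_sqrt ?lerDl ?lerDr ?sqr_ge0//;
  by rewrite addr_ge0 ?sqr_ge0.
Qed.

(** Here |z|^2 < e^2 / 2. This serves to fit a small rational box inside a disc. *)
Lemma normc_gt (e : R) z : `|Re z| < e / 2 -> `|Im z| < e / 2 ->
  `|z| < Complex e 0.
Proof.
case: z => x y /=; rewrite normc_def ltcE /= eqxx /= => xe ye.
have e0 : 0 < e by have := le_lt_trans (normr_ge0 _) xe; lra.
rewrite -[ltRHS]ger0_norm ?ltW// -sqrtr_sqr ltr_sqrt ?exprn_gt0//.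
rewrite -(ger0_norm (sqr_ge0 x)) -(ger0_norm (sqr_ge0 y)) !normrX.
have := normr_ge0 x; have := normr_ge0 y; nra.
Qed.

Lemma open_preimage_Re (A : set R) : open A ->
  open ([set z | A (Re z)] : set R[i]^o).
Proof.
rewrite openE => oA; apply/open_complexP => z /oA /nbhs_ballP[e /= e0 zA].
exists e => // w /normc_lt[+ _]; case: z w zA => [x y] [x' y'] /= zA wz.
by apply: zA; rewrite -ball_normE /= distrC.
Qed.

Lemma open_preimage_Im (A : set R) : open A ->
  open ([set z | A (Im z)] : set R[i]^o).
Proof.
rewrite openE => oA; apply/open_complexP => z /oA /nbhs_ballP[e /= e0 zA].
exists e => // w /normc_lt[_]; case: z w zA => [x y] [x' y'] /= zA wz.
by apply: zA; rewrite -ball_normE /= distrC.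
Qed.

(** * Borel measurability of complex functions *)

Lemma open_Cborel (U : set R[i]^o) : open U -> measurable (U : set (Cborel R)).
Proof. exact: sub_sigma_algebra. Qed.

(** Open intervals generate the Borel sets of the real line, and their preimages are open. *)
Lemma measurable_Re : measurable_fun [set: Cborel R] Re.
Proof.
apply: (measurability _ (RGenOpens.measurableE R)) => _ [_ [x [y ->]] <-].
by rewrite setTI; apply: open_Cborel; apply: open_preimage_Re; exact: itv_open.
Qed.

Lemma measurable_Im : measurable_fun [set: Cborel R] Im.
Proof.
apply: (measurability _ (RGenOpens.measurableE R)) => _ [_ [x [y ->]] <-].
by rewrite setTI; apply: open_Cborel; apply: open_preimage_Im; exact: itv_open.
Qed.

(** Stated by coordinates because [cintegral] integrates the real and imaginary parts separately. *)
Definition cmeasurable f :=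
  measurable_fun [set: Cborel R] (Re \o f) /\
  measurable_fun [set: Cborel R] (Im \o f).

Lemma cmeasurable_cst c : cmeasurable (fun=> c).
Proof. by split; exact: measurable_cst. Qed.

Lemma cmeasurable_id : cmeasurable id.
Proof. by split; [exact: measurable_Re | exact: measurable_Im]. Qed.

Lemma cmeasurableD f g : cmeasurable f -> cmeasurable g ->
  cmeasurable (fun z => f z + g z).
Proof.
move=> [f1 f2] [g1 g2]; split.
  by rewrite (_ : _ \o _ = (Re \o f) \+ (Re \o g));
    [exact: measurable_funD | apply/funext => z /=; rewrite ReD].
by rewrite (_ : _ \o _ = (Im \o f) \+ (Im \o g));
  [exact: measurable_funD | apply/funext => z /=; rewrite ImD].
Qed.

Lemma cmeasurableM f g : cmeasurable f -> cmeasurable g ->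
  cmeasurable (fun z => f z * g z).
Proof.
move=> [f1 f2] [g1 g2]; split.
  rewrite (_ : _ \o _ = (Re \o f) \* (Re \o g) \-
      (Im \o f) \* (Im \o g)).
    by apply: measurable_funB; exact: measurable_funM.
  by apply/funext => z /=; rewrite ReM.
rewrite (_ : _ \o _ = (Re \o f) \* (Im \o g) \+
    (Im \o f) \* (Re \o g)).
  by apply: measurable_funD; exact: measurable_funM.
by apply/funext => z /=; rewrite ImM.
Qed.

Lemma cmeasurableX f n : cmeasurable f -> cmeasurable (fun z => f z ^+ n).
Proof.
move=> mf; elim: n => [|n ih]; first exact: cmeasurable_cst.
by under eq_fun do rewrite exprS; exact: cmeasurableM.
Qed.

Lemma cmeasurable_sum I (s : seq I) (P : pred I) (F : I -> R[i] -> R[i]) :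
  (forall i, cmeasurable (F i)) ->
  cmeasurable (fun z => \sum_(i <- s | P i) F i z).
Proof.
move=> mF; elim: s => [|i s ih].
  by under eq_fun do rewrite big_nil; exact: cmeasurable_cst.
under eq_fun do rewrite big_cons.
by case: (P i) => //; exact: cmeasurableD.
Qed.

Lemma cmeasurableJ : cmeasurable conjc.
Proof.
split.
  by rewrite (_ : _ \o _ = Re); [exact: measurable_Re
     | apply/funext => z /=; rewrite ReJ].
rewrite (_ : _ \o _ = -%R \o Im).
  by apply: measurableT_comp => //; exact: measurable_Im.
by apply/funext => z /=; rewrite ImJ.
Qed.

Lemma cmeasurable_monomial i j : cmeasurable (fun z => conjc z ^+ i * z ^+ j).
Proof.
apply: cmeasurableM; apply: cmeasurableX; first exact: cmeasurableJ.
exact: cmeasurable_id.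
Qed.

(** * Continuity of the characteristic polynomial *)

Lemma continuous_conjc : continuous (conjc : R[i]^o -> R[i]^o).
Proof.
move=> z A /nbhs_ballP[e e0 zA]; apply/nbhs_ballP; exists e => // w.
rewrite -ball_normE /= => zwe; apply: zA; rewrite -ball_normE /= -rmorphB /=.
rewrite (_ : `|conjc (z - w)| = `|z - w|)//.
by rewrite !normc_def ReJ ImJ sqrrN.
Qed.

(** Makes the set where P is nonzero open, so that it can be tested against the support. *)
Lemma continuous_charP r a : continuous (charP r a : R[i]^o -> R[i]^o).
Proof.
have cM (f g : R[i]^o -> R[i]^o) : continuous f -> continuous g ->
    continuous (fun z : R[i]^o => f z * g z : R[i]^o).
  by move=> cf cg z; apply: (@continuousM R[i] R[i]^o) => //; [exact: cf|exact: cg].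
have cid : continuous (fun z : R[i]^o => z) by move=> z; exact: cvg_id.
have cX (f : R[i]^o -> R[i]^o) n : continuous f ->
    continuous (fun z : R[i]^o => f z ^+ n : R[i]^o).
  move=> cf; elim: n => [|n ih]; first exact: cst_continuous.
  by under eq_fun do rewrite exprS; exact: cM.
have cS (I : Type) (s : seq I) (P : pred I) (F : I -> R[i]^o -> R[i]^o) :
    (forall i, continuous (F i)) ->
    continuous (fun z : R[i]^o => \sum_(i <- s | P i) F i z : R[i]^o).
  move=> cF; elim: s => [|i s ih].
    by under eq_fun do rewrite big_nil; exact: cst_continuous.
  under eq_fun do rewrite big_cons.
  case: (P i); last exact: ih.
  move=> z.
  by apply: (@continuousD R[i] R[i]^o R[i]^o); [exact: cF|exact: ih].
move=> z; apply: (@continuousB R[i] R[i]^o R[i]^o (fun z => z ^+ r.+1)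
  (fun z => \sum_(l < r.+1) \sum_(k < r.+1 | (l + k <= r)%N)
     a l k * conjc z ^+ l * z ^+ k)); first exact: cX.
apply: (cS) => l; apply: cS => k; apply: (cM _ _ _ (cX _ _ cid)).
exact: (cM _ _ (@cst_continuous _ _ _) (cX _ _ continuous_conjc)).
Qed.

End ComplexPlane.

(** * Calculus of complex integrals *)

Section ComplexIntegralTheory.
Context {R : realType} (mu : {measure set (Cborel R) -> \bar R}).
Local Notation Re := (@complex.Re R).
Local Notation Im := (@complex.Im R).
Implicit Types (c d : R[i]) (f g : R[i] -> R[i]).

(** [is_moment] unfolds to this predicate at a monomial, so the rules below apply to moments and
    carry integrability along with the value. *)
Definition has_cintegral f c := cintegrable mu f /\ c = cintegral mu f.

Lemma eq_has_cintegral f g c : f =1 g -> has_cintegral f c -> has_cintegral g c.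
Proof. by move=> /funext ->. Qed.

Lemma has_cintegralD f g c d : has_cintegral f c -> has_cintegral g d ->
  has_cintegral (fun z => f z + g z) (c + d).
Proof.
move=> [[f1 f2] ->] [[g1 g2] ->]; split; [split|].
- under eq_fun do rewrite ReD EFinD.
  exact: (integrableD measurableT f1 g1).
- under eq_fun do rewrite ImD EFinD.
  exact: (integrableD measurableT f2 g2).
- rewrite /cintegral; under [in RHS]eq_Rintegral do rewrite ReD.
  under [X in _ = Complex _ X]eq_Rintegral do rewrite ImD.
  by rewrite !RintegralD.
Qed.

Lemma has_cintegralZ a f c : has_cintegral f c ->
  has_cintegral (fun z => a * f z) (a * c).
Proof.
have intZ k (h : Cborel R -> R) : mu.-integrable [set: Cborel R] (EFin \o h) ->
    mu.-integrable [set: Cborel R] (EFin \o (fun z => k * h z)).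
  move=> ih; rewrite (_ : _ \o _ = fun z => k%:E * (h z)%:E)%E//.
  exact: (integrableZl measurableT k ih).
move=> [[f1 f2] ->]; split; [split|].
- under eq_fun do rewrite ReM EFinB.
  by apply: (integrableB measurableT); exact: intZ.
- under eq_fun do rewrite ImM EFinD.
  by apply: (integrableD measurableT); exact: intZ.
- rewrite /cintegral; under [in RHS]eq_Rintegral do rewrite ReM.
  under [X in _ = Complex _ X]eq_Rintegral do rewrite ImM.
  rewrite RintegralB ?RintegralD ?RintegralZl//; try exact: intZ.
  by case: a.
Qed.

Lemma has_cintegralB f g c d : has_cintegral f c -> has_cintegral g d ->
  has_cintegral (fun z => f z - g z) (c - d).
Proof.
move=> fc gd; rewrite -(mulN1r d).
apply: (@eq_has_cintegral (fun z => f z + (-1) * g z)) => [z|].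
  by rewrite mulN1r.
by apply: has_cintegralD => //; exact: has_cintegralZ.
Qed.

Lemma has_cintegral0 : has_cintegral (fun=> 0) 0.
Proof.
split; first by split; exact: integrable0.
by rewrite /cintegral /= Rintegral_cst// mul0r.
Qed.

Lemma has_cintegral_sum I (s : seq I) (P : pred I) (F : I -> R[i] -> R[i]) C :
  (forall i, P i -> has_cintegral (F i) (C i)) ->
  has_cintegral (fun z => \sum_(i <- s | P i) F i z) (\sum_(i <- s | P i) C i).
Proof.
move=> FC; elim: s => [|i s ih].
  rewrite big_nil; apply: eq_has_cintegral has_cintegral0 => z.
  by rewrite big_nil.
rewrite big_cons; case: ifPn => Pi.
  apply: eq_has_cintegral (has_cintegralD _ _ _ _ (FC i Pi) ih) => z.
  by rewrite big_cons Pi.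
by apply: eq_has_cintegral ih => z; rewrite big_cons (negbTE Pi).
Qed.

Lemma has_cintegralJ f c : has_cintegral f c ->
  has_cintegral (fun z => conjc (f z)) (conjc c).
Proof.
move=> [[f1 f2] ->]; split; [split|].
- by under eq_fun do rewrite ReJ.
- under eq_fun do rewrite ImJ EFinN.
  exact: integrableN f2.
- rewrite /cintegral; under [in RHS]eq_Rintegral do rewrite ReJ.
  under [X in _ = Complex _ X]eq_Rintegral do rewrite ImJ -mulN1r.
  by rewrite RintegralZl// mulN1r.
Qed.

(** * Null sets, supports and zero sets *)

(** For each coordinate the integral of the absolute value is 0, hence finite, which yields
    integrability as well as the value. *)
Lemma ae0_has_cintegral f : cmeasurable f ->
  mu.-negligible [set z | f z != 0] -> has_cintegral f 0.
Proof.
have ae0 (h : Cborel R -> R) : measurable_fun [set: Cborel R] h ->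
    mu.-negligible [set z | h z != 0] ->
    mu.-integrable [set: Cborel R] (EFin \o h) /\
    Rintegral mu [set: Cborel R] h = 0.
  move=> mh h0.
  have mh' : measurable_fun [set: Cborel R] (EFin \o h) by exact/measurable_EFinP.
  have hae : ae_eq mu [set: Cborel R] (EFin \o h) (cst 0%E).
    apply: negligibleS h0 => z /= /not_implyP[_ hz].
    by apply/eqP => hz0; apply: hz; rewrite hz0.
  split.
    apply/integrableP; split => //.
    by rewrite (proj2 (ae_eq_integral_abs mu measurableT mh') hae).
  rewrite /Rintegral (ae_eq_integral (cst 0%E))// ?integral0//.
move=> [m1 m2] f0.
have [|i1 r1] := ae0 _ m1.
  by apply: negligibleS f0 => z /=; apply: contraNN => /eqP ->.
have [|i2 r2] := ae0 _ m2.
  by apply: negligibleS f0 => z /=; apply: contraNN => /eqP ->.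
by split => //; rewrite /cintegral r1 r2.
Qed.

(** The integrand has real part (Re f)^2 + (Im f)^2, and a nonnegative function with integral 0
    vanishes almost everywhere. *)
Lemma has_cintegral_normsq_eq0 f :
  has_cintegral (fun z => f z * conjc (f z)) 0 ->
  mu.-negligible [set z | f z != 0].
Proof.
move=> [[iRe _] [/esym int0 _]].
have ge0 z : 0 <= Re (f z * conjc (f z)).
  by rewrite ReM ReJ ImJ mulrN opprK -!expr2 addr_ge0 ?sqr_ge0.
have : (\int[mu]_(z in [set: Cborel R]) `|(Re (f z * conjc (f z)))%:E| = 0)%E.
  under eq_integral do rewrite abse_EFin ger0_norm//.
  (* [Rintegral] would also be 0 for an infinite integral; integrability excludes that case. *)
  by rewrite -[LHS]fineK ?integrable_fin_num//; congr EFin.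
move/(ae_eq_integral_abs mu measurableT (measurable_int _ iRe)).
apply: negligibleS => z /= fz0 /(_ I) [].
rewrite ReM ReJ ImJ mulrN opprK => /eqP.
rewrite paddr_eq0 ?sqr_ge0// -!expr2 ?sqr_ge0// !sqrf_eq0 => /andP[z1 z2].
by move: fz0; rewrite eq_complex z1 z2.
Qed.

(* Uses the countable base of open boxes with rational corners. *)
Lemma negligible_setC_msupp : mu.-negligible (~` msupp mu).
Proof.
pose box (p : rat * rat * (rat * rat)) : set (Cborel R) :=
  [set z | ratr p.1.1 < Re z < ratr p.1.2 /\ ratr p.2.1 < Im z < ratr p.2.2].
(* Only null boxes are kept; the empty set stands in for every other code, so the union is a
   countable union of null sets. *)
pose F n := if unpickle n is Some p then
  if pselect (mu.-negligible (box p)) then box p else set0 else set0.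
apply: (@negligibleS _ _ _ mu (\bigcup_n F n)); last first.
  apply: negligible_bigcup => n; rewrite /F.
  case: unpickle => [p|]; last exact: negligible_set0.
  by case: pselect => [//|?]; exact: negligible_set0.
move=> z /= /existsNP[U /not_implyP[oU /not_implyP[Uz /negP]]].
rewrite lt_neqAle measure_ge0 andbT negbK => /eqP/esym U0.
have [e e0 zU] := proj1 (open_complexP U) oU z Uz.
have e20 : 0 < e / 2 by rewrite divr_gt0.
(* With corners within e/2 of z, each coordinate of w - z stays below e/2 in absolute value for w in
   the box, so the box lies in U. *)
have rat_near (x : R) : exists pq : rat * rat,
    [/\ x - e / 2 < ratr pq.1, ratr pq.1 < x, x < ratr pq.2 & ratr pq.2 < x + e / 2].
  have [|p] := @rat_in_itvoo R (x - e / 2) x; first by lra.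
  have [|q] := @rat_in_itvoo R x (x + e / 2); first by lra.
  by rewrite !in_itv /= => /andP[? ?] /andP[? ?]; exists (p, q).
have [p [p1 p2 p3 p4]] := rat_near (Re z).
have [q [q1 q2 q3 q4]] := rat_near (Im z).
exists (pickle (p, q)); first exact: I.
rewrite /F pickleK; case: pselect => [?|[]] /=.
  by split; apply/andP.
(* The box is contained in the open null set U, so [F] did not discard it. *)
exists U; split; [exact: open_Cborel|exact: U0|move=> w /= [/andP[? ?] /andP[? ?]]].
by apply: zU; apply: normc_gt; rewrite ?(ReD, ImD, ReN, ImN) ltr_norml; lra.
Qed.

Lemma negligible_zeroset_of_msupp r a :
  msupp mu `<=` zeroset r a -> mu.-negligible [set z | charP r a z != 0].
Proof.
move=> suppZ; apply: negligibleS negligible_setC_msupp => z /= /eqP Pz /suppZ.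
exact: Pz.
Qed.

(** At a point of the support with P nonzero, the open set where P is nonzero would be a
    neighbourhood of positive measure. *)
Lemma msupp_sub_zeroset r a :
  mu.-negligible [set z | charP r a z != 0] -> msupp mu `<=` zeroset r a.
Proof.
move=> Pnull z zsupp; apply/eqP; apply/negPn/negP => Pz.
have oU : open ([set z | charP r a z != 0] : set R[i]^o).
  have := continuous_charP r a; move/continuousP => /(_ [set w | w != 0]).
  apply; rewrite (_ : [set w | _] = ~` [set 0]); last first.
    by apply/seteqP; split => w /= /eqP.
  apply: closed_openC; apply: accessible_closed_set1; apply: hausdorff_accessible.
  exact: norm_hausdorff.
have := zsupp _ oU Pz.
by rewrite (measure_negligible (open_Cborel _ oU) Pnull) ltxx.
Qed.

End ComplexIntegralTheory.

(** * The recurrence, the characteristic polynomial and the moments *)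

Section Recurrence.
Context {R : realType} (r : nat) (a : nat -> nat -> R[i]).

(** The right-hand side mirrors the recurrence at n = m + r; the exponent m + r + k - r, equal to m
    + k, keeps this shape for the match. *)
Lemma charP_monomial i m z : charP r a z * (conjc z ^+ i * z ^+ m) =
  conjc z ^+ i * z ^+ (m + r).+1 -
  \sum_(l < r.+1) \sum_(k < r.+1 | (l + k <= r)%N)
    a l k * (conjc z ^+ (l + i) * z ^+ (m + r + k - r)).
Proof.
rewrite /charP mulrBl; congr (_ - _).
  by rewrite mulrCA -exprD addSn addnC.
rewrite mulr_suml; apply: eq_bigr => l _; rewrite mulr_suml.
apply: eq_bigr => k _; rewrite addnAC addnK !exprD.
by rewrite -!mulrA; congr (_ * (_ * _)); rewrite mulrCA [z ^+ k * _]mulrC.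
Qed.

(** Conjugation swaps the two exponents, so the conjugate of P is again a combination of monomials
    and |P|^2 expands into products of P with monomials. *)
Lemma charP_conj z : conjc (charP r a z) = conjc z ^+ r.+1 -
  \sum_(l < r.+1) \sum_(k < r.+1 | (l + k <= r)%N)
    conjc (a l k) * (conjc z ^+ k * z ^+ l).
Proof.
rewrite /charP rmorphB rmorphXn rmorph_sum; congr (_ - _).
apply: eq_bigr => l _; rewrite rmorph_sum; apply: eq_bigr => k _.
by rewrite !rmorphM !rmorphXn /= conjcK -mulrA [conjc z ^+ k * _]mulrC.
Qed.

Context (gamma : nat -> nat -> R[i]) (hgamma : RDIS r a gamma).
Context (mu : {measure set (Cborel R) -> \bar R}).

Lemma moments_charP_null :
  (forall i j, is_moment mu i j (gamma i j)) ->
  mu.-negligible [set z | charP r a z != 0].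
Proof.
have [_ _ rec] := hgamma => mom; apply: has_cintegral_normsq_eq0.
(* The value is [gamma i (m + r).+1] minus itself, with one copy expanded by the recurrence. *)
have P0 i m : has_cintegral mu (fun z => charP r a z * (conjc z ^+ i * z ^+ m)) 0.
  rewrite -(subrr (gamma i (m + r).+1)) {2}rec ?leq_addl//.
  apply: eq_has_cintegral; first by move=> z; rewrite charP_monomial.
  apply: has_cintegralB; first exact: mom.
  apply: has_cintegral_sum => l _; apply: has_cintegral_sum => k _.
  by apply: has_cintegralZ; exact: mom.
have sum0 I (s : seq I) (P : pred I) (F : I -> R[i] -> R[i]) :
    (forall i, P i -> has_cintegral mu (F i) 0) ->
    has_cintegral mu (fun z => \sum_(i <- s | P i) F i z) 0.
  by move=> /has_cintegral_sum => /(_ s); rewrite big1.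
(* P times the expansion of its conjugate; the factor [z ^+ 0] gives the leading term the form
   required by [P0]. *)
apply: (@eq_has_cintegral _ _ (fun z =>
    charP r a z * (conjc z ^+ r.+1 * z ^+ 0) -
    \sum_(l < r.+1) \sum_(k < r.+1 | (l + k <= r)%N)
      conjc (a l k) * (charP r a z * (conjc z ^+ k * z ^+ l)))) => [z|].
  rewrite charP_conj mulrBr expr0 mulr1 mulr_sumr; congr (_ - _).
  apply: eq_bigr => l _; rewrite mulr_sumr; apply: eq_bigr => k _.
  by rewrite mulrCA.
rewrite -[X in has_cintegral _ _ X](subrr 0).
apply: has_cintegralB; first exact: P0.
apply: (sum0) => l _; apply: sum0 => k _.
by rewrite -[X in has_cintegral _ _ X](mulr0 (conjc (a l k))); exact: has_cintegralZ.
Qed.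

Lemma cmeasurable_charP : cmeasurable (charP r a).
Proof.
rewrite (_ : charP r a = fun z => conjc z ^+ 0 * z ^+ r.+1 + (-1) *
  \sum_(l < r.+1) \sum_(k < r.+1 | (l + k <= r)%N)
    a l k * (conjc z ^+ l * z ^+ k)).
  apply: cmeasurableD; first exact: cmeasurable_monomial.
  apply: cmeasurableM; first exact: cmeasurable_cst.
  apply: cmeasurable_sum => l; apply: cmeasurable_sum => k.
  apply: cmeasurableM; first exact: cmeasurable_cst.
  exact: cmeasurable_monomial.
apply/funext => z; rewrite /charP expr0 mul1r mulN1r; congr (_ - _).
by apply: eq_bigr => l _; apply: eq_bigr => k _; rewrite mulrA.
Qed.

Lemma moments_of_initial :
  (forall i j, (i <= j)%N -> (j <= r)%N -> is_moment mu i j (gamma i j)) ->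
  mu.-negligible [set z | charP r a z != 0] ->
  forall i j, is_moment mu i j (gamma i j).
Proof.
have [_ sym rec] := hgamma => init Pnull i j.
have [d] := ubnP (i + j); elim: d i j => // d IH i j ijd.
(* Conjugation exchanges i and j and preserves i + j, so the degree bound survives. *)
wlog leij : i j ijd / (i <= j)%N.
  move=> H; have [|/ltnW ji] := leqP i j; first exact: H.
  rewrite sym; apply: (@eq_has_cintegral _ _ (fun z => conjc (conjc z ^+ j * z ^+ i))).
    by move=> z; rewrite rmorphM !rmorphXn /= conjcK mulrC.
  by apply: has_cintegralJ; apply: H; rewrite // addnC.
have [jr|] := leqP j r; first exact: init.
case: j ijd leij => // j ijd leij; rewrite ltnS => rj.
pose m := (j - r)%N; have jE : j = (m + r)%N by rewrite subnK.
rewrite rec// -[X in is_moment _ _ _ X]add0r.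
(* The monomial is split into a multiple of P, which is null almost everywhere and accounts for the
   added 0, and the terms of the recurrence. *)
apply: (@eq_has_cintegral _ _ (fun z => charP r a z * (conjc z ^+ i * z ^+ m) +
    \sum_(l < r.+1) \sum_(k < r.+1 | (l + k <= r)%N)
      a l k * (conjc z ^+ (l + i) * z ^+ (j + k - r)))) => [z|].
  by rewrite charP_monomial -jE subrK.
apply: has_cintegralD.
  apply: ae0_has_cintegral.
    by apply: cmeasurableM; [exact: cmeasurable_charP|exact: cmeasurable_monomial].
  by apply: negligibleS Pnull => z /=; apply: contraNN => /eqP ->; rewrite mul0r.
apply: has_cintegral_sum => l _; apply: has_cintegral_sum => k lkr.
(* As l + k <= r <= j, the degree (l + i) + (j + k - r) is at most i + j, below the current i + j +
   1. The first index may exceed the second, hence the induction over all pairs. *)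
by apply: has_cintegralZ; apply: IH; lia.
Qed.

End Recurrence.

Theorem proposition7 (R : realType) (r : nat) (a gamma : nat -> nat -> R[i])
    (hgamma : RDIS r a gamma) :
  (exists mu : {measure set (Cborel R) -> \bar R},
     forall i j : nat, is_moment mu i j (gamma i j))
  <->
  (exists mu : {measure set (Cborel R) -> \bar R},
     (forall i j : nat, (i <= j)%N -> (j <= r)%N ->
        is_moment mu i j (gamma i j)) /\
     msupp mu `<=` zeroset r a).
Proof.
(* The same measure serves in both directions. *)
split=> -[mu] => [mom|[init suppZ]]; exists mu.
  split=> [i j _ _|]; first exact: mom.
  by apply: msupp_sub_zeroset; exact: moments_charP_null mom.
apply: (moments_of_initial _ _ _ hgamma _ init).
exact: negligible_zeroset_of_msupp.
Qed.
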